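(* A cubic graph has a $(2,2)$-ChNZF if and only if it is $3$-edge-colourable.
   Context: An $\mathbb{R}^2$-flow on a graph $G=(V,E)$ consists of an orientation of the edges and a map $\varphi\colon E\to\mathbb{R}^2$ such that at every vertex the sum of values on incoming edges equals the sum on outgoing edges. A $(2,2)$-ChNZF is an $\mathbb{R}^2$-flow with $\|\varphi(e)\|_\infty=1$ for every edge $e$ (i.e. $1\le\|\varphi(e)\|_\infty\le 1$), where $\|(x,y)\|_\infty=\max(|x|,|y|)$. *)

(* Defs.v *)
From HB Require Import structures.
From mathcomp Require Import all_boot all_order all_algebra.
From mathcomp Require Import reals.

Set Implicit Arguments.
Unset Strict Implicit.
Unset Printing Implicit Defensive.

Import Order.TTheory GRing.Theory Num.Theory.
Local Open Scope ring_scope.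

(* A finite graph; parallel edges and loops are allowed.  Edges are
   undirected: the booleans only name the two ends of an edge, and no
   definition below depends on which end gets which name. *)
Record graph := Graph {
  vertex : finType;
  edge : finType;
  endpoint : edge -> bool -> vertex
}.

(* The pairs (e, b) are the edge ends, so a loop counts twice. *)
Definition degree (G : graph) (v : vertex G) : nat :=
  #|[set x : edge G * bool | endpoint x.1 x.2 == v]|.

Definition cubic (G : graph) : Prop := forall v : vertex G, degree v = 3%N.

(* Distinct edge ends at a common vertex have different colours.  For e <> f
   this says that adjacent edges get different colours; for e = f it says that
   a graph with a loop (an edge adjacent to itself) has no proper colouring. *)
Definition proper_edge_colouring (G : graph) (k : nat)
    (c : edge G -> 'I_k) : Prop :=
  forall (e f : edge G) (a b : bool),
    (e, a) <> (f, b) -> endpoint e a = endpoint f b -> c e <> c f.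

Definition edge_colourable (G : graph) (k : nat) : Prop :=
  exists c : edge G -> 'I_k, proper_edge_colouring c.

(* [o e] is the name of the end of [e] that is its head. *)
Definition orientation (G : graph) : Type := edge G -> bool.

Definition head_of (G : graph) (o : orientation G) (e : edge G) : vertex G :=
  endpoint e (o e).

Definition tail_of (G : graph) (o : orientation G) (e : edge G) : vertex G :=
  endpoint e (~~ o e).

Definition is_flow (G : graph) (A : zmodType) (o : orientation G)
    (phi : edge G -> A) : Prop :=
  forall v : vertex G,
    \sum_(e | head_of o e == v) phi e = \sum_(e | tail_of o e == v) phi e.

Definition norm_inf (R : realType) (p : R * R) : R := Num.max `|p.1| `|p.2|.

Definition is_ChNZF_2_2 (R : realType) (G : graph) (o : orientation G)
    (phi : edge G -> R * R) : Prop :=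
  is_flow o phi /\ forall e : edge G, norm_inf (phi e) = 1.

Definition has_ChNZF_2_2 (R : realType) (G : graph) : Prop :=
  exists (o : orientation G) (phi : edge G -> R * R), is_ChNZF_2_2 o phi.

(* Main.v *)
Require Import Defs.
From HB Require Import structures.
From mathcomp Require Import all_boot all_order all_algebra.
From mathcomp Require Import reals.
From mathcomp Require Import lra.

                                                                               
                                                                         
                                                                               
                                                                              
                                                                           
                                                                 

                                                                          
                                                                               
                                                                             
                                

Set Implicit Arguments.
Unset Strict Implicit.
Unset Printing Implicit Defensive.

Import Order.TTheory GRing.Theory Num.Theory.
Local Open Scope ring_scope.

(** Flow to colouring: the boundary of the unit square is cut at the hexagon with vertices [±(1,0)],
    [±(1,1)], [±(0,1)] into three antipodally symmetric classes. Two points of one class have a sum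
    of max-norm below 1 or above 1, never equal to 1. At a cubic vertex the three signed values sum
    to zero, so any two of them add up to minus the third, of norm 1, and must lie in different
    classes ([square_class_neq]). Symmetry makes the class independent of the orientation.

    Colouring to flow: the edges not coloured [k] form disjoint cycles; sending one unit around each
    gives a flow with values [±1] off colour [k] and 0 on it ([bicoloured_flow]). Two such flows,
    for different [k], are the two coordinates. *)

Section EdgeEnds.

Variable G : graph.
Implicit Types (v : vertex G) (x : edge G * bool).

Definition end_vertex x : vertex G := endpoint x.1 x.2.

Definition ends_at v := [set x | end_vertex x == v].

Definition opposite_end x := (x.1, ~~ x.2).

(** Inflow counts positively at each end, so conservation becomes a zero sum over ends, and the two
    ends of a loop cancel. *)
Definition end_value (A : zmodType) (o : orientation G) (phi : edge G -> A) x : A :=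
  if x.2 == o x.1 then phi x.1 else - phi x.1.

Lemma sum_end_value (A : zmodType) (o : orientation G) (phi : edge G -> A) v :
  \sum_(x in ends_at v) end_value o phi x =
    \sum_(e | head_of o e == v) phi e - \sum_(e | tail_of o e == v) phi e.
Proof.
under eq_bigl do rewrite inE.
rewrite big_mkcond /= -(pair_bigA _ (fun e b =>
  if end_vertex (e, b) == v then end_value o phi (e, b) else 0)) /=.
rewrite [X in _ = X - _]big_mkcond [X in _ = _ - X]big_mkcond -sumrB.
apply: eq_bigr => e _; rewrite big_bool /end_value /end_vertex /head_of /tail_of /=.
case: (o e) => /=; do 2!case: eqP => _; rewrite ?subr0 ?sub0r ?add0r ?addr0 //.
by rewrite addrC.
Qed.

Lemma is_flowP (A : zmodType) (o : orientation G) (phi : edge G -> A) :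
  is_flow o phi <-> forall v, \sum_(x in ends_at v) end_value o phi x = 0.
Proof.
split=> flow v; first by rewrite sum_end_value flow subrr.
by apply/eqP; rewrite -subr_eq0 -sum_end_value flow.
Qed.

End EdgeEnds.

(** * From flows to colourings: antipodal classes of the unit square *)

Section SquareClasses.

Variable R : realType.
Implicit Types p q r : R * R.

Definition square_class p : 'I_3 :=
  if (`|p.2| == 1) && (0 <= p.1 * p.2 < 1) then 0
  else if (`|p.1| == 1) && (0 <= p.1 * p.2 < 1) then 1 else 2%:R.

Lemma square_classN p : square_class (- p) = square_class p.
Proof. by rewrite /square_class /= !normrN mulrNN. Qed.

Lemma norm_inf_eq1 p : norm_inf p = 1 ->
  [/\ -1 <= p.1 <= 1, -1 <= p.2 <= 1 &
      [\/ p.1 = 1, p.1 = -1, p.2 = 1 | p.2 = -1]].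
Proof.
rewrite /norm_inf => np.
have p1_le : `|p.1| <= 1 by rewrite -np le_max lexx.
have p2_le : `|p.2| <= 1 by rewrite -np le_max lexx orbT.
split; [by rewrite -ler_norml | by rewrite -ler_norml | move: np].
rewrite maxEle; case: ifP => _ /eqP; rewrite eqr_norml ler01 andbT;
  case/orP=> /eqP; by [constructor 1|constructor 2|constructor 3|constructor 4].
Qed.

Lemma norm1E (x : R) : (`|x| == 1) = (x == 1) || (x == -1).
Proof. by rewrite eqr_norml ler01 andbT. Qed.

(** With the sign [e] naming a side of the square, each case is an antipodal pair of pieces; once
    [e] is fixed, all constraints are linear. *)
Variant square_class_spec p : 'I_3 -> Prop :=
| SquareClass0 e of e = 1 \/ e = -1 & p.2 = e & 0 <= e * p.1 < 1 :
    square_class_spec p 0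
| SquareClass1 e of e = 1 \/ e = -1 & p.1 = e & 0 <= e * p.2 < 1 :
    square_class_spec p 1
| SquareClass2H e of e = 1 \/ e = -1 & p.1 = e & -1 <= e * p.2 < 0 :
    square_class_spec p 2%:R
| SquareClass2V e of e = 1 \/ e = -1 & p.2 = e & -1 <= e * p.1 < 0 :
    square_class_spec p 2%:R
| SquareClass2D e of e = 1 \/ e = -1 & p.1 = e & p.2 = e :
    square_class_spec p 2%:R.

Lemma square_classP p : norm_inf p = 1 -> square_class_spec p (square_class p).
Proof.
case: p => x y /norm_inf_eq1[/= x_le y_le xy]; rewrite /square_class !norm1E /=.
have [[e eE xE]|[e eE yE]] : (exists2 e, e = 1 \/ e = -1 & x = e) \/
    (exists2 e, e = 1 \/ e = -1 & y = e).
  by case: xy => ->; [left; exists 1|left; exists (-1)|right; exists 1|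
    right; exists (-1)]; auto.
- have -> : (x == 1) || (x == -1).
    by rewrite xE; case: eE => ->; rewrite eqxx ?orbT.
  case: ifP => [/andP[/orP[]/eqP yE xy01]|_].
  (* The point is a corner, where the product of coordinates is 1 or -1, outside [0, 1). *)
  + by exfalso; subst; case: eE xy01 => ->; lra.
  + by exfalso; subst; case: eE xy01 => ->; lra.
  rewrite /= xE; case: ifP => [xy01|/negbT]; first exact: (SquareClass1 eE).
  rewrite negb_and -ltNge -leNgt => /orP[ey|ey].
    by apply: (SquareClass2H eE) => //=; rewrite ey andbT; case: (eE) => ->; lra.
  by apply: (SquareClass2D eE) => //=; case: eE ey => ->; lra.
- have -> : (y == 1) || (y == -1).
    by rewrite yE; case: eE => ->; rewrite eqxx ?orbT.
  rewrite /= yE mulrC; case: ifP => [xy01|xy01]; first exact: (SquareClass0 eE).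
  rewrite xy01 andbF; move/negbT: xy01.
  rewrite negb_and -ltNge -leNgt => /orP[ex|ex].
    by apply: (SquareClass2V eE) => //=; rewrite ex andbT; case: (eE) => ->; lra.
  by apply: (SquareClass2D eE) => //=; case: eE ex => ->; lra.
Qed.

(** If [p] and [q] shared a class, either some coordinate of [p + q] would exceed 1 in absolute
    value, or both would be below 1; so [r] could not have norm 1. *)
Lemma square_class_neq p q r : norm_inf p = 1 -> norm_inf q = 1 ->
  norm_inf r = 1 -> p + q + r = 0 -> square_class p <> square_class q.
Proof.
move=> np nq nr pqr.
have [r1 r2 r12] := norm_inf_eq1 nr.
have e1 : p.1 + q.1 + r.1 = 0 by have := congr1 fst pqr.
have e2 : p.2 + q.2 + r.2 = 0 by have := congr1 snd pqr.
case: (square_classP np) => e [] -> {e} ? ?;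
  case: (square_classP nq) => e [] -> {e} ? ? // _;
  clear np nq nr pqr; case: r12 => ?; lra.
Qed.

End SquareClasses.

Lemma cubic_third_end (G : graph) (v : vertex G) (x y : edge G * bool) :
  cubic G -> x \in ends_at v -> y \in ends_at v -> x != y ->
  exists z, forall (A : zmodType) (F : edge G * bool -> A),
    \sum_(t in ends_at v) F t = F x + F y + F z.
Proof.
move=> /(_ v) card3 xv yv xy.
have yvx : y \in ends_at v :\ x by rewrite in_setD1 eq_sym xy.
have /eqP/cards1P[z zE] : #|ends_at v :\ x :\ y| = 1%N.
  have := cardsD1 x (ends_at v); have := cardsD1 y (ends_at v :\ x).
  have -> : #|ends_at v| = 3%N := card3.
  by rewrite xv yvx => ->; rewrite !add1n => -[].
exists z => A F.
by rewrite (big_setD1 x) //= (big_setD1 y) //= zE big_set1 addrA.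
Qed.

Lemma flow_colourable (R : realType) (G : graph) : cubic G ->
  has_ChNZF_2_2 R G -> edge_colourable G 3.
Proof.
move=> cub [o [phi [/is_flowP flow norm1]]].
exists (fun e => square_class (phi e)) => e f a b /eqP ea_fb vE.
pose w := end_value o phi.
have wnorm x : norm_inf (w x) = 1.
  rewrite -(norm1 x.1) /w /end_value; case: ifP => // _.
  by rewrite /norm_inf /= !normrN.
have wclass x : square_class (w x) = square_class (phi x.1).
  by rewrite /w /end_value; case: ifP; rewrite ?square_classN.
have [||z sumE] := cubic_third_end (v := endpoint e a) cub _ _ ea_fb.
- by rewrite inE.
- by rewrite inE /end_vertex -vE.
rewrite -(wclass (e, a)) -(wclass (f, b)).
by apply: (@square_class_neq _ _ _ (w z)) => //; rewrite -sumE flow.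
Qed.

                                                                           
                                           
(** Joining each [x] to [f x] and [g x] gives cycles alternating between [f] and [g], hence even and
    2-colourable. The two colour classes of a cycle are orbits of [g \o f], swapped by both
    involutions. *)
Lemma involutions_alternating (T : finType) (f g : T -> T) :
  involutive f -> involutive g ->
  (forall x, f x != x) -> (forall x, g x != x) ->
  exists s : T -> bool,
    (forall x, s (f x) = ~~ s x) /\ (forall x, s (g x) = ~~ s x).
Proof.
move=> fK gK f_neq g_neq.
pose h := g \o f.
have h_inj : injective h by apply: inj_comp; apply: inv_inj.
(* Conjugation by [f] inverts [h]. *)
have hfh x : h (f (h x)) = f x by rewrite /h /= fK gK.
have iter_hf k x : iter k h (f (iter k h x)) = f x.
  by elim: k => // k IHk; rewrite iterSr /= hfh.
have f_orbit x : ~~ fconnect h x (f x).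
  apply/negP => /iter_findex; set k := findex _ _ _ => kE.
  (* If [f x] is [k] steps of [h] from [x], the point [y] halfway satisfies [f y = y] for even [k]
     and [f y = g (f y)] for odd [k]: a fixed point either way. *)
  have [y fyE] : exists y, f y = iter (odd k) h y.
    exists (iter k./2 h x); have inj_it : injective (iter k./2 h).
      by elim: k./2 => //= n IHn y z /h_inj/IHn.
    apply: inj_it; rewrite iter_hf -kE -!iterD; congr (iter _ _ _).
    by rewrite -[LHS]odd_double_half -addnn addnCA addnA.
  move: fyE; case: (odd k) => /= fyE; last by have := f_neq y; rewrite fyE eqxx.
  by have := g_neq (f y); rewrite {2}fyE eqxx.
(* Ranking the orbits by their roots breaks the tie between the orbits of [x] and [f x]. *)
pose rk x := enum_rank (froot h x).
have rootP x y : (froot h x == froot h y) = fconnect h x y.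
  exact: root_connect (fconnect_sym h_inj) x y.
have rk_neq x : (rk x != rk (f x) :> nat).
  by rewrite (inj_eq (@ord_inj _)) (inj_eq enum_rank_inj) rootP.
have rkh x : rk (h x) = rk x.
  by congr enum_rank; apply/esym/eqP; rewrite rootP fconnect1.
exists (fun x => (rk x < rk (f x))%N); split=> x.
  by rewrite fK ltn_neqAle eq_sym rk_neq -leqNgt.
have -> : rk (g x) = rk (f x) by rewrite -(rkh (f x)) /h /= fK.
have -> : rk (f (g x)) = rk x by rewrite -rkh /h /= fK gK.
by rewrite ltn_neqAle eq_sym rk_neq -leqNgt.
Qed.

(** * From colourings to flows: circulations on two-coloured cycles *)

Section ColouringToFlow.

Variables (R : realType) (G : graph) (c : edge G -> 'I_3).
Hypotheses (cub : cubic G) (c_proper : proper_edge_colouring c).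

Lemma colour_end_inj v : {in ends_at v &, injective (fun x => c x.1)}.
Proof.
move=> [e a] [f b]; rewrite !inE => /eqP xv /eqP yv /= cE.
apply/eqP/negPn/negP => /eqP neq; apply: c_proper neq _ cE.
by rewrite /end_vertex /= in xv yv; rewrite xv yv.
Qed.

Lemma colour_at_exists v i : exists x, (x \in ends_at v) && (c x.1 == i).
Proof.
have /eqP imE : [set c x.1 | x in ends_at v] == setT.
  rewrite eqEcard subsetT cardsT card_ord (card_in_imset (@colour_end_inj v)).
  by have := cub v; rewrite /degree /ends_at /end_vertex => ->.
have : i \in [set c x.1 | x in ends_at v] by rewrite imE inE.
by case/imsetP=> x xv ->; exists x; rewrite xv eqxx.
Qed.

Definition end_of v i := xchoose (colour_at_exists v i).

Lemma end_vertex_end_of v i : end_vertex (end_of v i) = v.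
Proof. by have /andP[] := xchooseP (colour_at_exists v i); rewrite inE => /eqP. Qed.

Lemma colour_end_of v i : c (end_of v i).1 = i.
Proof. by have /andP[_ /eqP] := xchooseP (colour_at_exists v i). Qed.

Lemma end_of_colour x : end_of (end_vertex x) (c x.1) = x.
Proof.
apply: (@colour_end_inj (end_vertex x)); rewrite ?inE //.
- by rewrite end_vertex_end_of.
- exact: colour_end_of.
Qed.

Lemma sum_ends_at (A : zmodType) (F : edge G * bool -> A) v :
  \sum_(x in ends_at v) F x = \sum_i F (end_of v i).
Proof.
rewrite (reindex_onto (end_of v) (fun x => c x.1)) /=.
  by apply: eq_bigl => i; rewrite inE end_vertex_end_of colour_end_of !eqxx.
by move=> x; rewrite inE => /eqP <-; rewrite end_of_colour.
Qed.

                                                                  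
(** The three colours sum to 0 modulo 3, so the colour other than [k] and [i] is [- (k + i)]. *)
Lemma third_colour_neq (k i : 'I_3) : i != k ->
  [/\ - (k + i) != k, - (k + i) != i & - (k - (k + i)) = i].
Proof.
move=> ik; split; last by rewrite opprB addrAC subrr add0r.
all: by case: k i ik => [[|[|[|?]]] ?] // [[|[|[|?]]] ?].
Qed.

(** Off colour [k], this passes through the vertex to the next edge of the cycle. Ends coloured [k]
    are paired along their edge only to keep the map a fixed-point-free involution; the flow
    vanishes there. *)
Definition bicoloured_mate (k : 'I_3) x :=
  if c x.1 == k then opposite_end x
  else end_of (end_vertex x) (- (k + c x.1)).

Lemma bicoloured_mateK k : involutive (bicoloured_mate k).
Proof.
move=> x; rewrite /bicoloured_mate; case: (eqVneq (c x.1) k) => [ck|ck] /=.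
  by rewrite ck eqxx /opposite_end /= negbK; case: (x).
have [nk _ kK] := third_colour_neq ck.
by rewrite colour_end_of (negPf nk) end_vertex_end_of kK end_of_colour.
Qed.

Lemma opposite_end_neq x : opposite_end x != x :> edge G * bool.
Proof. by case: x => e []; rewrite xpair_eqE andbF. Qed.

Lemma bicoloured_mate_neq k x : bicoloured_mate k x != x.
Proof.
rewrite /bicoloured_mate; case: (eqVneq (c x.1) k) => [_|ck].
  exact: opposite_end_neq.
have [_ ni _] := third_colour_neq ck.
by apply: contraNneq ni => xE; rewrite -[X in _ == X](congr1 (fun y => c y.1) xE)
  colour_end_of.
Qed.

Lemma bicoloured_flow k : exists phi : edge G -> R,
  is_flow (fun=> true) phi /\
  forall e, `|phi e| = if c e == k then 0 else 1.
Proof.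
have opK : involutive (@opposite_end G) by case=> e b; rewrite /opposite_end negbK.
have [s [s_op s_mate]] := involutions_alternating opK (@bicoloured_mateK k)
  opposite_end_neq (bicoloured_mate_neq k).
(* The sign flips along an edge, as the two ends of one flow value must, and across a vertex, where
   the two nonzero contributions then cancel. *)
pose w x : R := if c x.1 == k then 0 else (-1) ^+ s x.
exists (fun e => w (e, true)); split; last first.
  by move=> e; rewrite /w /=; case: ifP; rewrite ?normr0 // normr_sign.
have wE x : end_value (fun=> true) (fun e => w (e, true)) x = w x.
  case: x => e [] //; rewrite /end_value /w /=; case: ifP; rewrite ?oppr0 //.
  by rewrite (s_op (e, true)) => _; rewrite signrN.
apply/is_flowP => v; under eq_bigr do rewrite wE.
rewrite sum_ends_at (bigD1 k) //= {1}/w colour_end_of eqxx add0r.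
have k1 : k + 1 != k by case: (k) => [[|[|[|?]]] ?].
have [nk ni _] := third_colour_neq k1.
rewrite (bigD1 (k + 1)) //= (bigD1 (- (k + (k + 1)))) /=; last by rewrite nk.
rewrite big_pred0 ?addr0; last first.
  by case: (k) => [[|[|[|?]]] ?] // [[|[|[|?]]] ?].
rewrite /w !colour_end_of (negPf k1) (negPf nk).
have <- : bicoloured_mate k (end_of v (k + 1)) = end_of v (- (k + (k + 1))).
  by rewrite /bicoloured_mate colour_end_of (negPf k1) end_vertex_end_of.
by rewrite s_mate signrN addrN.
Qed.

(** Colours 0, 1 and 2 receive values [(0,±1)], [(±1,0)] and [(±1,±1)]. *)
Lemma colouring_flow : has_ChNZF_2_2 R G.
Proof.
have [phi0 [flow0 norm0]] := bicoloured_flow 0.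
have [phi1 [flow1 norm1]] := bicoloured_flow 1.
exists (fun=> true), (fun e => (phi0 e, phi1 e)); split=> [v|e]; last first.
  rewrite /norm_inf /= norm0 norm1.
  case: (eqVneq (c e) 0) => [->|_] /=; first by rewrite max_r.
  by case: eqP; rewrite ?maxxx // max_l.
have fstD := big_morph fst (fun p q : R * R => erefl (p + q).1) erefl.
have sndD := big_morph snd (fun p q : R * R => erefl (p + q).2) erefl.
rewrite [LHS]surjective_pairing [RHS]surjective_pairing.
by rewrite !fstD !sndD; congr (_, _); [apply: flow0|apply: flow1].
Qed.

End ColouringToFlow.

Theorem theorem19 (R : realType) (G : graph) (hG : cubic G) :
  has_ChNZF_2_2 R G <-> edge_colourable G 3.
Proof.
split; first exact: flow_colourable.
by case=> c; apply: colouring_flow.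
Qed.
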